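(* Let $m$ be a positive integer. Then for all but finitely many primes $q$, the following holds: if $mq \equiv 1 \pmod 4$, then $\operatorname{disc}(F_{mq})$ is not the square of a rational number.
   Context: For $n \geq 1$, $F_n(x) = 1 + x + \frac{x^2}{2} + \cdots + \frac{x^n}{n} \in \mathbf{Q}[x]$. The discriminant of a polynomial $P$ of degree $n$ with leading coefficient $a_n$ is $\operatorname{disc} P = (-1)^{\binom{n}{2}} a_n^{-1}\operatorname{Res}(P,P')$. *)

(* Defs.v *)
From mathcomp Require Import all_boot all_order all_algebra.

Set Implicit Arguments.
Unset Strict Implicit.
Unset Printing Implicit Defensive.

Import GRing.Theory.
Local Open Scope ring_scope.

Definition F (n : nat) : {poly rat} :=
  1 + \sum_(1 <= k < n.+1) (k%:R)^-1 *: 'X^k.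

(* [resultant] uses a Sylvester matrix with coefficients in increasing degree,
   so [resultant p q] is (-1) ^ (deg p * deg q) times the classical Res(p, q),
   i.e. lead_coef p ^ deg q * \prod_(p(a) = 0) q(a). For q = P' in
   characteristic 0 the sign is (-1) ^ (n * (n - 1)) = 1, so the two agree. *)
Definition disc (K : fieldType) (P : {poly K}) : K :=
  (-1) ^+ 'C((size P).-1, 2) * (lead_coef P)^-1 * resultant P P^`().

(* Main.v *)
(** The derivative of [F n] is [T = 1 + x + ... + x^(n-1)], so for [n = m * q]
    the discriminant is, up to sign, [n * Res(F n, T)].  For [q > m] large, clear the
    denominators of [F n] by [N = M * q] with [M] prime to [q]: since [q] kills
    every term [x^k / k] with [q] not dividing [k], modulo [q] the result is
    proportional to [h(x^q)] with [h = \sum_(1 <= j <= m) x^j / j].  If [h] is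
    prime to [x^m - 1] modulo [q], then [h(x^q)] is prime to [x^n - 1], hence to
    [T], so [q] does not divide [Res(N F n, T) = N^(n-1) Res(F n, T)].  As [n - 1]
    is even, [disc (F n)] is [n] times an integer prime to [q] times a rational
    square, and [q] divides [n] exactly once: it is not a square.

    That [h] is prime to [x^m - 1] modulo all but finitely many [q] amounts to
    the nonvanishing of an integral resultant, which holds because it is odd:
    a single [j <= m], the largest power [2^e], has maximal 2-adic valuation, so
    clearing denominators turns [h] into [x^(2^e)] modulo 2. *)
Require Import Defs.
From mathcomp Require Import all_boot all_order all_algebra.

Set Implicit Arguments.
Unset Strict Implicit.

Import GRing.Theory.
Local Open Scope ring_scope.

(** * Resultants, scaling and reduction modulo primes *)

(** Both degrees survive [f], so the two Sylvester matrices have the same shape and correspond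
    entrywise. *)
Lemma resultant_map (R S : nzRingType) (f : {rmorphism R -> S})
    (p q : {poly R}) :
  f (lead_coef p) != 0 -> f (lead_coef q) != 0 ->
  f (resultant p q) = resultant (map_poly f p) (map_poly f q).
Proof.
move=> fp fq; rewrite /resultant /Sylvester_mx !size_map_poly_id0 //.
rewrite -det_map_mx map_col_mx.
by congr (\det (col_mx _ _)); apply: map_lin1_mx => v;
  rewrite /= map_poly_rV rmorphM /= map_rVpoly.
Qed.

Lemma resultantZl (R : idomainType) (c : R) (p q : {poly R}) : c != 0 ->
  resultant (c *: p) q = c ^+ (size q).-1 * resultant p q.
Proof.
move=> c0; rewrite /resultant /Sylvester_mx size_scale //.
set A := lin1_mx _; set B := lin1_mx _; set A' := lin1_mx _.
have ->: A = c *: A'.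
  apply/row_matrixP=> i; rewrite linearZ /= !rowE !mul_rV_lin1 /=.
  by rewrite -scalerAr linearZ.
have ->: col_mx (c *: A') B = block_mx c%:M 0 0 1%:M *m col_mx A' B.
  by rewrite mul_block_col !mul0mx mul1mx addr0 add0r mul_scalar_mx.
by rewrite det_mulmx det_ublock det_scalar det1 mulr1.
Qed.

Lemma intr_Fp_eq0 (p : nat) (z : int) : prime p ->
  (z%:~R == 0 :> 'F_p) = (p %| `|z|)%N.
Proof.
move=> pp; rewrite (dvdn_pcharf (pchar_Fp pp)).
by rewrite [in LHS](intEsign z) rmorphM rmorph_sign mulf_eq0 signr_eq0.
Qed.

Lemma dvdn_resultant (p : nat) (P Q : {poly int}) : prime p ->
  ~~ (p %| `|lead_coef P|)%N -> ~~ (p %| `|lead_coef Q|)%N ->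
  (p %| `|resultant P Q|)%N =
    ~~ coprimep (map_poly (intr : int -> 'F_p) P) (map_poly intr Q).
Proof.
move=> pp; rewrite -!intr_Fp_eq0 // => P0 Q0.
rewrite (resultant_map (f := intr : {rmorphism int -> 'F_p})) //.
(* Failure of coprimality also allows a zero gcd, which [P0] excludes. *)
rewrite resultant_eq0 /coprimep neq_ltn ltnS leqn0 size_poly_eq0 gcdp_eq0.
by rewrite -lead_coef_eq0 lead_coef_map_eq // (negPf P0).
Qed.

Lemma even_logn_rat_sqr (p : nat) (z : int) (s : rat) :
  z%:~R = s ^+ 2 -> ~~ odd (logn p `|z|).
Proof.
have [->|z0 zs] := eqVneq z 0; first by rewrite logn0.
have E : z * denq s ^+ 2 = numq s ^+ 2.
  apply: (@intr_inj rat); rewrite rmorphM /= zs !rmorphXn /= -exprMn.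
  by rewrite -{1}(divq_num_den s) divfK // intr_eq0 denq_eq0.
have := congr1 (fun z : int => odd (logn p `|z|)) E.
rewrite abszM !abszX lognM ?expn_gt0 ?absz_gt0 ?z0 ?denq_eq0 //.
by rewrite !lognX oddD !oddM /= addbF => ->.
Qed.

(** * The harmonic polynomial modulo 2 and modulo large primes *)

(** Take [L] to be [2 ^ e] times the odd part of the factorial of [m]. Then [L %/ j] is odd exactly
    when [j] has 2-adic valuation [e], and [m < 2 ^ e.+1] leaves only [j = 2 ^ e]. *)
Lemma lcm_two_part (m : nat) : (0 < m)%N ->
  exists L e : nat, [/\ (0 < L)%N, (0 < 2 ^ e <= m)%N &
    forall j, (0 < j <= m)%N ->
      (j %| L)%N /\ odd (L %/ j) = (j == 2 ^ e)%N].
Proof.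
move=> m0; pose e := trunc_log 2 m.
exists (2 ^ e * m`!`_2^')%N, e; split.
- by rewrite muln_gt0 expn_gt0 part_gt0.
- by rewrite expn_gt0 trunc_logP.
move=> j /andP[j0 jm].
have jE : (j = 2 ^ logn 2 j * j`_2^')%N by rewrite -p_part partnC.
have je : (logn 2 j <= e)%N.
  apply: trunc_log_max => //; apply: leq_trans jm.
  by rewrite dvdn_leq // pfactor_dvdnn.
have d1 : (2 ^ logn 2 j %| 2 ^ e)%N by rewrite dvdn_exp2l.
have d2 : (j`_2^' %| m`!`_2^')%N.
  by rewrite partn_dvd ?fact_gt0 // dvdn_fact ?j0.
have L0 : (0 < 2 ^ e * m`!`_2^')%N by rewrite muln_gt0 expn_gt0 part_gt0.
have dvd_jL : (j %| 2 ^ e * m`!`_2^')%N by rewrite jE dvdn_mul.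
have logL : logn 2 (2 ^ e * m`!`_2^')%N = e.
  rewrite lognM ?expn_gt0 ?part_gt0 // pfactorK //.
  rewrite (_ : logn 2 _ = 0)%N ?addn0 //.
  by apply/logn_coprime/(pnat_coprime (pnat_id _))/part_pnat.
split=> //.
have := logn_gt0 2 (2 ^ e * m`!`_2^' %/ j)%N.
rewrite mem_primes divn_gt0 // (dvdn_leq L0 dvd_jL) dvdn2 /= => E.
rewrite -[odd _]negbK -E logn_div // logL subn_gt0 -leqNgt.
apply/idP/eqP=> [ej | ->]; last by rewrite pfactorK.
have {ej je} ej : logn 2 j = e by apply/eqP; rewrite eqn_leq je.
have /andP[_] := trunc_log_bounds (isT : 1 < 2)%N m0; rewrite -/e => m_lt.
move: jE (leq_ltn_trans jm m_lt); rewrite ej => ->.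
rewrite expnS [(2 * _)%N]mulnC ltn_pmul2l ?expn_gt0 //.
(* The odd part of [j] is positive and less than 2, so it is 1. *)
by have := part_gt0 2^'%N j; case: (j`_2^')%N => [|[|k]] //; rewrite muln1.
Qed.

(* The term [j = 0] vanishes because [L %/ 0 = 0]. *)
Definition harm (L m : nat) : {poly int} := \poly_(j < m.+1) (L %/ j)%:R.

Lemma coprimep_addZr (K : fieldType) (c : K) (P Q : {poly K}) :
  coprimep (P + c *: Q) Q = coprimep P Q.
Proof.
by rewrite addrC -mul_polyC coprimep_sym coprimep_addl_mul coprimep_sym.
Qed.

(* Adding a multiple of ['X^m - 1] makes the leading coefficient 1, so that the
   resultant with ['X^m - 1] commutes with reduction modulo every prime. *)
Lemma harm_monic (L m : nat) : (0 < m)%N ->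
  harm L m + (1 - (L %/ m)%:R) *: ('X^m - 1) \is monic.
Proof.
move=> m0; set a := _%:R; pose S : {poly int} := \poly_(j < m) (L %/ j)%:R.
have ->: harm L m = S + a *: 'X^m by rewrite /harm /S !poly_def big_ord_recr.
have ->: S + a *: 'X^m + (1 - a) *: ('X^m - 1) = 'X^m + (S - (1 - a)%:P).
  rewrite scalerBr alg_polyC -addrA [RHS]addrCA; congr (_ + _).
  by rewrite addrA -scalerDl subrKC scale1r.
have sizeS : (size (S - (1 - a)%:P)%R <= m)%N.
  rewrite (leq_trans (size_polyD _ _)) // geq_max size_polyN size_poly.
  by rewrite (leq_trans (size_polyC_leq1 _)).
by rewrite monicE lead_coefDl ?lead_coefXn // size_polyXn.
Qed.

Lemma map_Xn_sub_1 (R S : nzRingType) (f : {rmorphism R -> S}) (n : nat) :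
  map_poly f ('X^n - 1) = 'X^n - 1.
Proof. by rewrite rmorphB /= map_polyXn rmorph1. Qed.

Lemma harm_coprime (m : nat) : (0 < m)%N ->
  exists L B : nat, [/\ (0 < L)%N,
    forall j, (0 < j <= m)%N -> (j %| L)%N &
    forall q, prime q -> (B < q)%N ->
      coprimep (map_poly intr (harm L m)) ('X^m - 1 : {poly 'F_q})].
Proof.
move=> m0; have [L [e [L0 e_m Lj]]] := lcm_two_part m0.
pose c : int := 1 - (L %/ m)%:R; pose H := harm L m + c *: ('X^m - 1).
have H1 : H \is monic by apply: harm_monic.
have X1 : ('X^m - 1 : {poly int}) \is monic by exact: monicXnsubC.
have red q : prime q -> (q %| `|resultant H ('X^m - 1)|)%N =
    ~~ coprimep (map_poly intr (harm L m)) ('X^m - 1 : {poly 'F_q}).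
  move=> qp; have q1 : ~~ (q %| `|1 : int|)%N by rewrite dvdn1 gtn_eqF ?prime_gt1.
  rewrite dvdn_resultant ?(monicP H1) ?(monicP X1) //.
  rewrite [in LHS]rmorphD /= map_polyZ /= map_Xn_sub_1.
  by rewrite coprimep_addZr.
have odd_res : ~~ (2 %| `|resultant H ('X^m - 1)|)%N.
  rewrite red // negbK.
  have ->: map_poly intr (harm L m) = 'X^(2 ^ e) :> {poly 'F_2}.
    apply/polyP=> -[|i]; rewrite coef_map coef_poly coefXn /=.
      by rewrite divn0 ltn_eqF ?expn_gt0.
    case: ifP => [im|/negbT]; last first.
      by rewrite -leqNgt => /(leq_ltn_trans (proj2 (andP e_m)))/gtn_eqF->.
    rewrite rmorph_nat -(Fp_nat_mod (isT : prime 2)) modn2.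
    by have [_ ->] := Lj i.+1 im.
  apply: coprimep_expl; rewrite coprimep_sym coprimepX rootE !hornerE expr0n.
  by rewrite gtn_eqF // sub0r oppr_eq0 oner_eq0.
(* An odd resultant is nonzero, so no prime above its absolute value divides it. *)
exists L, `|resultant H ('X^m - 1)|%N; split=> // [j /Lj[] //|q qp ltq].
rewrite -[coprimep _ _]negbK -red // gtnNdvd // absz_gt0.
by apply: contraNneq odd_res => ->.
Qed.

(* [maxn 1 i] absorbs the extra constant term [1] of [F n]. *)
Lemma F_poly (n : nat) : F n = \poly_(i < n.+1) (maxn 1 i)%:R^-1.
Proof.
rewrite poly_def big_ord_recl /= invr1 scale1r expr0 /F; congr (1 + _).
rewrite big_add1 big_mkord.
by apply: eq_bigr => i _; rewrite (maxn_idPr _).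
Qed.

Lemma size_F (n : nat) : size (F n) = n.+1.
Proof.
by rewrite F_poly size_poly_eq // invr_eq0 Num.Theory.pnatr_eq0 -lt0n leq_max.
Qed.

Lemma lead_coef_F (n : nat) : (0 < n)%N -> lead_coef (F n) = n%:R^-1.
Proof.
move=> n0; rewrite lead_coefE size_F F_poly coef_poly ltnSn.
by rewrite (maxn_idPr n0).
Qed.

Definition scaled_F (N n : nat) : {poly int} :=
  \poly_(i < n.+1) (N %/ maxn 1 i)%:R.

Lemma map_scaled_F (N n : nat) :
  (forall k, (0 < k <= maxn 1 n)%N -> (k %| N)%N) ->
  map_poly intr (scaled_F N n) = N%:R *: F n.
Proof.
move=> dN; apply/polyP=> i.
rewrite coef_map coefZ F_poly !coef_poly /=; case: ifP => [ni|_]; last first.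
  by rewrite mulr0.
rewrite rmorph_nat /=.
have dNi : (maxn 1 i %| N)%N.
  rewrite dN // leq_max geq_max !leq_max /=.
  by rewrite -[(i <= n)%N]/(i < n.+1)%N ni orbT.
rewrite -[in RHS](divnK dNi) natrM mulfK //.
by rewrite Num.Theory.pnatr_eq0 -lt0n leq_max.
Qed.

Lemma deriv_F (n : nat) :
  (F n)^`() = map_poly intr (\poly_(i < n) (1 : int)).
Proof.
apply/polyP=> i; rewrite coef_map coef_deriv F_poly !coef_poly ltnS.
case: ifP => _; last by rewrite mul0rn.
have i0 : i.+1%:R != 0 :> rat by rewrite Num.Theory.pnatr_eq0.
by rewrite (maxn_idPr _) // -[LHS]mulr_natr; exact: (mulVf i0).
Qed.

(** Every positive [k <= m * q] prime to [q] divides [M]. The outer factors [L] and [M] balance the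
    two common denominators: L * (M / j) = M * (L / j). *)
Lemma scaled_F_mod_prime (L m q : nat) : prime q -> (0 < m < q)%N ->
  (forall j, (0 < j <= m)%N -> (j %| L)%N) ->
  let M := ((m * q)`!`_q^')%N in
  L%:R *: map_poly intr (scaled_F (M * q) (m * q)) =
    M%:R *: (map_poly intr (harm L m) \Po 'X^q) :> {poly 'F_q}.
Proof.
move=> qp /andP[m0 mq] Lj M; have q0 := prime_gt0 qp.
have q_char : q%:R = 0 :> 'F_q by apply: pchar_Fp_0.
have dM k : (0 < k <= m * q)%N -> ~~ (q %| k)%N -> (k %| M)%N.
  move=> /andP[k0 kn] qk; rewrite -[k](part_pnat_id (pi := q^'%N)) ?p'natE //.
  by rewrite partn_dvd ?fact_gt0 // dvdn_fact ?k0.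
apply/polyP=> i; rewrite !coefZ coef_comp_poly_Xn // !coef_map !coef_poly /=.
have [/dvdnP[j ->]|qi] := boolP (q %| i)%N.
  rewrite mulnK // !ltnS leq_pmul2r //; case: ifP => [jm|_]; last first.
    by rewrite !mulr0.
  rewrite !rmorph_nat; case: j jm => [|j] jm.
    (* Constant term: [M * q] vanishes modulo [q], in agreement with [L %/ 0 = 0]. *)
    by rewrite mul0n divn0 divn1 natrM q_char !mulr0.
  rewrite (maxn_idPr _) ?muln_gt0 // divnMr // -!natrM.
  rewrite !muln_divA ?Lj // ?[(M * L)%N]mulnC // dM //.
    by rewrite (leq_trans jm) // leq_pmulr.
  by rewrite gtnNdvd // (leq_ltn_trans jm).
case: ifP => [ni|_]; rewrite ?mulr0 // rmorph_nat.
have i0 : (0 < i)%N by rewrite lt0n; apply: contraNneq qi => ->.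
by rewrite (maxn_idPr i0) mulnC -muln_divA ?dM ?i0 // natrM q_char mul0r mulr0.
Qed.

Lemma resultant_scaled_F (m L q : nat) : prime q -> (0 < m < q)%N ->
  (0 < L < q)%N -> (forall j, (0 < j <= m)%N -> (j %| L)%N) ->
  coprimep (map_poly intr (harm L m)) ('X^m - 1 : {poly 'F_q}) ->
  ~~ (q %| `|resultant (scaled_F ((m * q)`!`_q^' * q) (m * q))
                     (\poly_(i < m * q) 1%R)|)%N.
Proof.
move=> qp mq Lq Lj co; set M := ((m * q)`!`_q^')%N.
have [/andP[m0 ltmq] q0] := (mq, prime_gt0 qp).
have n0 : (0 < m * q)%N by rewrite muln_gt0 m0.
have qM : ~~ (q %| M)%N by rewrite -p'natE ?part_pnat.
have mM : (m %| M)%N.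
  have q'm : (q^').-nat m by rewrite p'natE ?gtnNdvd.
  rewrite -[X in (X %| _)%N](part_pnat_id q'm) partn_dvd ?fact_gt0 //.
  by rewrite dvdn_fact // m0 leq_pmulr.
have qMm : ~~ (q %| M %/ m)%N.
  by apply: contra qM => qMm; rewrite -(divnK mM) dvdn_mulr.
have Mm0 : (M %/ m)%:R != 0 :> int.
  by rewrite Num.Theory.pnatr_eq0; apply: contraNneq qMm => ->.
(* The leading coefficient [M %/ m] is prime to [q], so reduction modulo [q] keeps the degree. *)
have F_n : (M * q %/ maxn 1 (m * q) = M %/ m)%N.
  by rewrite (maxn_idPr n0) divnMr.
have lcF : lead_coef (scaled_F (M * q) (m * q)) = (M %/ m)%:R.
  by rewrite lead_coef_poly //= F_n.
have lcT : lead_coef (\poly_(i < m * q) (1 : int)) = 1.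
  by rewrite lead_coef_poly.
rewrite dvdn_resultant ?lcF ?lcT ?dvdn1 //; last first.
- by rewrite gtn_eqF ?prime_gt1.
- by rewrite natz absz_nat.
have natF0 k : ~~ (q %| k)%N -> k%:R != 0 :> 'F_q.
  by rewrite (dvdn_pcharf (pchar_Fp qp)).
have L0 : ~~ (q %| L)%N by case/andP: Lq => *; rewrite gtnNdvd.
rewrite negbK -(coprimepZl _ _ (natF0 _ L0)) scaled_F_mod_prime // -/M.
rewrite coprimepZl ?natF0 //.
(* Substituting ['X^q] preserves coprimality and turns ['X^m - 1] into ['X^(m * q) - 1], of which
   the derivative of [F (m * q)] is a factor. *)
have := coprimep_comp_poly 'X^q co; rewrite rmorphB /= rmorph1 comp_Xn_poly.
rewrite -exprM mulnC subrX1 coprimepMr => /andP[_].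
rewrite poly_def [in X in _ -> X]rmorph_sum /=.
by under [in X in _ -> X]eq_bigr do rewrite scale1r map_polyXn.
Qed.

Lemma disc_F_not_square (m q : nat) : prime q -> (0 < m < q)%N ->
  (m * q = 1 %[mod 4])%N ->
  let N := ((m * q)`!`_q^' * q)%N in
  ~~ (q %| `|resultant (scaled_F N (m * q)) (\poly_(i < m * q) 1%R)|)%N ->
  ~ (exists r : rat, disc (F (m * q)) = r ^+ 2).
Proof.
move=> qp /andP[m0 ltmq] mod4 N.
set T := \poly_(_ < _) _; set res := resultant _ _ => q_res [r].
have q0 := prime_gt0 qp; have n0 : (0 < m * q)%N by rewrite muln_gt0 m0.
have N0 : (0 < N)%N by rewrite muln_gt0 part_gt0.
have dN k : (0 < k <= maxn 1 (m * q))%N -> (k %| N)%N.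
  rewrite (maxn_idPr n0) => /andP[k0 kn].
  rewrite -[k](partnC q) // mulnC; apply: dvdn_mul.
    by rewrite partn_dvd ?fact_gt0 // dvdn_fact ?k0.
  (* Since [k <= m * q < q ^ 2], a single factor [q] in [N] suffices. *)
  rewrite p_part -[X in (_ %| X)%N]expn1 dvdn_exp2l // leqNgt.
  apply/negP=> log2; have : (q ^ 2 <= k)%N.
    by rewrite dvdn_leq // pfactor_dvdn.
  by rewrite leqNgt (leq_ltn_trans kn) // expnS expn1 ltn_pmul2r.
have [t nE] : exists t, (m * q = t * 4 + 1)%N.
  by exists ((m * q) %/ 4)%N; rewrite {1}(divn_eq (m * q) 4) mod4.
have lcF : lead_coef (scaled_F N (m * q)) != 0.
  have Nn : (N %/ maxn 1 (m * q))%:R != 0 :> int.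
    rewrite Num.Theory.pnatr_eq0 (maxn_idPr n0) -lt0n divn_gt0 //.
    by rewrite dvdn_leq // dN // n0 leq_maxr.
  by rewrite lead_coef_poly.
have sizeT : size T = (m * q)%N by rewrite size_poly_eq ?oner_eq0.
have lcT : lead_coef T = 1 by rewrite /T lead_coef_poly.
have N0Q : N%:R != 0 :> rat by rewrite Num.Theory.pnatr_eq0 -lt0n.
have resE : res%:~R =
    N%:R ^+ (m * q).-1 * resultant (F (m * q)) (F (m * q))^`().
  rewrite (resultant_map (f := intr : {rmorphism int -> rat})) ?lcT ?intr_eq0 //.
  rewrite map_scaled_F // resultantZl // deriv_F.
  by rewrite size_map_poly_id0 ?sizeT // lcT oner_eq0.
rewrite /disc size_F lead_coef_F // invrK => discE.
have even_bin : 'C(m * q, 2) = (t * (t * 4 + 1)).*2.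
  rewrite bin2 nE addn1 /= -[RHS]doubleK -!muln2 -!mulnA -[4%N]/(2 * 2)%N.
  by rewrite mulnCA.
(* The sign is trivial because the binomial is even; multiplying the discriminant by the square
   [N ^ (4 * t)] gives an integral square. *)
have sq : ((m * q)%:Z * res)%:~R = (r * N%:R ^+ (t.*2)) ^+ 2 :> rat.
  have tE : (t.*2 * 2 = (m * q).-1)%N by rewrite nE addn1 -muln2 -mulnA.
  rewrite rmorphM /= resE exprMn -exprM tE -discE -signr_odd even_bin.
  by rewrite odd_double mul1r mulrA mulrAC.
have := even_logn_rat_sqr q sq.
rewrite abszM absz_nat -mulnA logn_Gauss ?prime_coprime ?gtnNdvd //.
rewrite mulnC logn_Gauss ?prime_coprime //.
by rewrite logn_prime // eqxx.
Qed.

Theorem theorem1p3 (m : nat) (hm : (0 < m)%N) :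
  exists S : seq nat,
    forall q : nat, prime q -> q \notin S ->
      (m * q = 1 %[mod 4])%N ->
      ~ (exists r : rat, disc (F (m * q)) = r ^+ 2).
Proof.
have [L [B [L0 Lj co]]] := harm_coprime hm.
(* Excluding everything up to the sum secures three bounds at once: [q > m], [q > L] to keep [L]
   invertible modulo [q], and [q > B] for coprimality. *)
exists (iota 0 (m + L + B).+1) => q qp.
rewrite mem_iota add0n ltnS -ltnNge => big.
have mq : (0 < m < q)%N by rewrite hm (leq_ltn_trans _ big) // -addnA leq_addr.
have Lq : (0 < L < q)%N by rewrite L0 (leq_ltn_trans _ big) // addnAC leq_addl.
move=> mod4; apply: disc_F_not_square => //.
apply: resultant_scaled_F Lq Lj _ => //.
by rewrite co // (leq_ltn_trans _ big) // leq_addl.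
Qed.
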